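(* Let $n$ be a positive integer. Let $C$ be the Cartan subalgebra of $\mathfrak{su}(n)$ consisting of the zero-trace skew-hermitian diagonal $n\times n$ complex matrices, and let $$C'=\mathrm{Circ}(n)\cap\mathfrak{su}(n).$$ Then $C$ and $C'$ are two orthogonal Cartan subalgebras of $\mathfrak{su}(n)$, with respect to minus the Killing form of $\mathfrak{su}(n)$.
   Context: $\mathrm{Circ}(n)$ denotes the space of all complex circulant $n\times n$ matrices, i.e. matrices of the form $$\begin{pmatrix} a_0 & a_1 & \cdots & a_{n-2} & a_{n-1}\\ a_{n-1} & a_0 & \cdots & a_{n-3} & a_{n-2}\\ \vdots & \vdots & \ddots & \vdots & \vdots\\ a_2 & a_3 & \cdots & a_0 & a_1\\ a_1 & a_2 & \cdots & a_{n-1} & a_0\end{pmatrix}$$ with $a_0,\dots,a_{n-1}\in\mathbb{C}$. $\mathfrak{su}(n)$ is the real Lie algebra of trace-zero skew-hermitian complex $n\times n$ matrices. Two subspaces are orthogonal if every element of one is orthogonal to every element of the other. *)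

(* Defs.v *)
From HB Require Import structures.
From mathcomp Require Import all_boot all_order all_algebra.
From mathcomp Require Import complex.
From mathcomp Require Import reals ring.

Set Implicit Arguments.
Unset Strict Implicit.
Unset Printing Implicit Defensive.

Import Order.TTheory GRing.Theory Num.Theory.
Local Open Scope ring_scope.
Local Open Scope sesquilinear_scope.

HB.mixin Record Vector_isLie (K : fieldType) (L : Type) of Vector K L := {
  lie : L -> L -> L;
  lie_linearl : forall v, linear (lie^~ v);
  lie_linearr : forall u, linear (lie u);
  liexx : forall u, lie u u = 0;
  lie_jacobi : forall u v w,
    lie u (lie v w) + lie v (lie w u) + lie w (lie u v) = 0
}.

#[short(type="lieType")]
HB.structure Definition Lie (K : fieldType) :=
  { L of Vector K L & Vector_isLie K L }.

Section LieTheory.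
Variables (K : fieldType) (L : lieType K).
Implicit Types (u v x y : L) (U V W : {vspace L}).

HB.instance Definition _ u := GRing.isLinear.Build K L L *:%R (@lie K L u)
  (lie_linearr u).

Definition ad u : 'End(L) := linfun (lie u).

Lemma adE u v : ad u v = lie u v.
Proof. exact: lfunE. Qed.

Definition lftrace (f : 'End(L)) : K :=
  \tr (passmx.mxof (vbasis {:L}) (vbasis {:L}) f).

Definition killing u v : K := lftrace (ad u \o ad v)%VF.

(* [U, V] is the linear span of all the brackets, see [memv_lie], [lievP]. *)
Definition liev U V : {vspace L} :=
  <<[seq lie u v | u <- vbasis U, v <- vbasis V]>>%VS.

Lemma memv_lie U V : {in U & V, forall u v, lie u v \in liev U V}.
Proof.
move=> u v /coord_vbasis-> /coord_vbasis->.
rewrite linear_sum; apply: memv_suml => j _; rewrite linearZ memvZ //=.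
set w := _`_j; have lieDl a b : lie (a + b) w = lie a w + lie b w.
  by have := lie_linearl w 1 a b; rewrite !scale1r.
have lie0l : lie 0 w = 0 by apply: (addIr (lie 0 w)); rewrite -lieDl !add0r.
rewrite (big_morph (lie^~ w) lieDl lie0l); apply: memv_suml => i _.
have := lie_linearl w (coord (vbasis U) i u) (vbasis U)`_i 0.
rewrite lie0l !addr0 => ->; rewrite memvZ // memv_span //.
by apply/allpairsP; exists ((vbasis U)`_i, w); rewrite !memt_nth.
Qed.

Lemma lievP U V W :
  reflect {in U & V, forall u v, lie u v \in W} (liev U V <= W)%VS.
Proof.
apply: (iffP idP) => [sUVW u v Uu Vv | sUVW].
  by rewrite (subvP sUVW) ?memv_lie.
apply/span_subvP=> _ /allpairsP[[u v] /= [Uu Vv ->]].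
by rewrite sUVW ?vbasis_mem.
Qed.

Definition subalgebra U : bool := (liev U U <= U)%VS.

Definition lower_central U k : {vspace L} := iter k (liev U) U.

Definition lie_nilpotent U : Prop := exists k, lower_central U k = 0%VS.

Definition self_normalizing U : Prop :=
  forall x, {in U, forall u, lie x u \in U} -> x \in U.

Definition cartan_subalgebra U : Prop :=
  [/\ subalgebra U, lie_nilpotent U & self_normalizing U].

Definition orthogonal_wrt (B : L -> L -> K) U V : Prop :=
  {in U & V, forall u v, B u v = 0}.

End LieTheory.

(* Complex matrices as a real vector space.  An alias of 'M[R[i]]_(m, n) is
   needed because the latter is already a vector space over R[i]. *)

Definition cmx (R : rcfType) (m n : nat) : Type := 'M[R[i]]_(m, n).

Section ComplexMatrices.
Variable R : rcfType.

Section Cmx.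
Variables m n : nat.
Notation M := (cmx R m n).

HB.instance Definition _ := GRing.Zmodule.copy M 'M[R[i]]_(m, n).

Definition cmx_scale (r : R) (A : M) : M :=
  (r%:C)%C *: (A : 'M[R[i]]_(m, n)).

Fact cmx_scaleA a b A : cmx_scale a (cmx_scale b A) = cmx_scale (a * b) A.
Proof. by rewrite /cmx_scale scalerA -rmorphM. Qed.
Fact cmx_scale1 : left_id 1 cmx_scale.
Proof. by move=> A; rewrite /cmx_scale rmorph1 scale1r. Qed.
Fact cmx_scaleDr : right_distributive cmx_scale +%R.
Proof. by move=> a A B; rewrite /cmx_scale scalerDr. Qed.
Fact cmx_scaleDl A : {morph cmx_scale^~ A : a b / a + b}.
Proof. by move=> a b; rewrite /cmx_scale rmorphD scalerDl. Qed.

HB.instance Definition _ := GRing.Zmodule_isLmodule.Build R M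
  cmx_scaleA cmx_scale1 cmx_scaleDr cmx_scaleDl.

Lemma cmx_scaleE (r : R) (A : M) i j : (r *: A) i j = (r%:C)%C * A i j.
Proof. by rewrite mxE. Qed.

Lemma cmxDE (A B : M) i j : (A + B) i j = A i j + B i j.
Proof. by rewrite mxE. Qed.

Definition cmx_coord (A : M) : 'rV[R]_(m * n + m * n) :=
  row_mx (mxvec (map_mx (@complex.Re R) A)) (mxvec (map_mx (@complex.Im R) A)).

Definition cmx_of_coord (v : 'rV[R]_(m * n + m * n)) : M :=
  \matrix_(i, j) Complex (vec_mx (lsubmx v) i j) (vec_mx (rsubmx v) i j).

Fact cmx_vect : Vector.axiom (m * n + m * n) M.
Proof.
exists cmx_coord.
  move=> r A B; rewrite /cmx_coord scale_row_mx add_row_mx.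
  rewrite -!linearP; congr (row_mx (mxvec _) (mxvec _));
    apply/matrixP=> i j; rewrite !mxE.
    by case: (A i j) (B i j) => a b [c d] /=; rewrite mul0r subr0.
  by case: (A i j) (B i j) => a b [c d] /=; rewrite mul0r addr0.
exists cmx_of_coord => [A | v].
  apply/matrixP=> i j; rewrite /cmx_of_coord /cmx_coord.
  by rewrite mxE row_mxKl row_mxKr !mxvecK !mxE; case: (A i j).
rewrite /cmx_coord -[RHS]hsubmxK -[lsubmx v in RHS]vec_mxK.
rewrite -[rsubmx v in RHS]vec_mxK.
by congr (row_mx (mxvec _) (mxvec _)); apply/matrixP=> i j; rewrite !mxE.
Qed.

HB.instance Definition _ := Lmodule_hasFinDim.Build R M cmx_vect.

End Cmx.

Section SpecialUnitary.
Variable n : nat.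
Notation M := (cmx R n n).

(* Zero exactly on skew-hermitian matrices. *)
Definition skew_defect (A : M) : M := (A : 'M[R[i]]_n)^t* + A.

(* The trace, as a real-linear map to 1 x 1 complex matrices. *)
Definition trace_cmx (A : M) : cmx R 1 1 := (\tr (A : 'M[R[i]]_n))%:M.

Fact skew_defect_linear : linear skew_defect.
Proof.
move=> r A B; apply/matrixP=> i j.
rewrite !mxE rmorphD rmorphM /= conj_Creal; last first.
  by rewrite realE !lecR -realE num_real.
by rewrite mulrDr addrACA.
Qed.

Fact trace_cmx_linear : linear trace_cmx.
Proof.
move=> r A B; apply/matrixP=> i j; rewrite !mxE !ord1 !mulr1n.
rewrite -[r *: A]/((r%:C)%C *: (A : 'M[R[i]]_n)).
by rewrite (linearP (@mxtrace _ _)).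
Qed.

HB.instance Definition _ := GRing.isLinear.Build R M M *:%R
  skew_defect skew_defect_linear.
HB.instance Definition _ := GRing.isLinear.Build R M (cmx R 1 1) *:%R
  trace_cmx trace_cmx_linear.

Definition su_space : {vspace M} :=
  (lker (linfun skew_defect) :&: lker (linfun trace_cmx))%VS.

Lemma mem_su_space (A : M) : (A \in su_space) =
  ((A : 'M[R[i]]_n)^t* == - (A : 'M[R[i]]_n)) && (\tr (A : 'M[R[i]]_n) == 0).
Proof.
rewrite memv_cap !memv_ker !lfunE /= addr_eq0; congr (_ && _).
apply/eqP/eqP => [/matrixP/(_ 0 0) | trA0].
  by rewrite !mxE eqxx mulr1n.
by apply/matrixP => i j; rewrite !mxE trA0 mul0rn.
Qed.

Definition su : Type := subvs_of su_space.
HB.instance Definition _ := Vector.copy su (subvs_of su_space).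

Definition su_val (x : su) : M := vsval x.

Definition commutator (A B : M) : M :=
  (A : 'M[R[i]]_n) *m B - (B : 'M[R[i]]_n) *m A.

(* The commutator stays in su(n), so the projection changes nothing: see
   [su_lieE]. *)
Definition su_lie (x y : su) : su :=
  vsproj su_space (commutator (su_val x) (su_val y)).

Lemma su_lieE x y : su_val (su_lie x y) = commutator (su_val x) (su_val y).
Proof.
rewrite /su_lie /su_val vsprojK // mem_su_space.
case: x y => A /=; rewrite mem_su_space => /andP[/eqP hA _].
case=> B /=; rewrite mem_su_space => /andP[/eqP hB _].
apply/andP; split; last by rewrite raddfB /= mxtrace_mulC subrr.
rewrite /commutator raddfB /= map_mxB !trmx_mul !map_mxM hA hB.
by rewrite !mulNmx !mulmxN !opprK opprB.
Qed.

Lemma commutator_linearl B : linear (commutator^~ B).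
Proof.
move=> r A A'; rewrite /commutator.
rewrite -[r *: A]/((r%:C)%C *: (A : 'M[R[i]]_n)).
rewrite -[RHS]/((r%:C)%C *: (commutator A B : 'M[R[i]]_n) + _).
rewrite mulmxDl mulmxDr -scalemxAl -scalemxAr opprD addrACA.
by rewrite -scalerN -scalerDr.
Qed.

Lemma commutatorC A B : commutator A B = - commutator B A.
Proof. by rewrite /commutator opprB. Qed.

Lemma su_val_linear : linear su_val.
Proof. by move=> r x y; rewrite /su_val linearP. Qed.

Lemma su_val_inj : injective su_val.
Proof. exact: val_inj. Qed.

HB.instance Definition _ := GRing.isLinear.Build R su M *:%R
  su_val su_val_linear.

Fact su_lie_linearl y : linear (su_lie^~ y).
Proof.
move=> r x x'; apply: su_val_inj.
by rewrite linearP /= !su_lieE linearP commutator_linearl.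
Qed.

Fact su_lie_xx x : su_lie x x = 0.
Proof. by apply: su_val_inj; rewrite su_lieE linear0 /commutator subrr. Qed.

Fact su_lie_linearr x : linear (su_lie x).
Proof.
move=> r y y'; apply: su_val_inj.
rewrite linearP /= !su_lieE linearP commutatorC commutator_linearl.
by rewrite opprD -scalerN -!commutatorC.
Qed.

Fact su_lie_jacobi x y z :
  su_lie x (su_lie y z) + su_lie y (su_lie z x) + su_lie z (su_lie x y) = 0.
Proof.
apply: su_val_inj; rewrite !linearD linear0 /= !su_lieE /commutator.
move: (su_val x) (su_val y) (su_val z) => A B C.
rewrite !mulmxBl !mulmxBr !mulmxA !opprB.
set p1 := A *m B *m C; set p2 := A *m C *m B; set p3 := B *m C *m A.
set p4 := B *m A *m C; set p5 := C *m A *m B; set p6 := C *m B *m A.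
apply/matrixP=> i j; rewrite !mxE.
by ring.
Qed.

HB.instance Definition _ := Vector_isLie.Build R su
  su_lie_linearl su_lie_linearr su_lie_xx su_lie_jacobi.

Lemma su_val_lie (x y : su) :
  su_val (lie x y) = commutator (su_val x) (su_val y).
Proof. exact: su_lieE. Qed.

Lemma su_valP (x : su) : su_val x \in su_space.
Proof. exact: valP. Qed.

Definition diag_cmx (a : cmx R 1 n) : M := diag_mx (a : 'rV[R[i]]_n).

(* (j - i) mod n *)
Definition ord_diff (i j : 'I_n) : 'I_n :=
  Ordinal (ltn_pmod (j + (n - i)) (leq_ltn_trans (leq0n i) (ltn_ord i))).

Definition circ_cmx (a : cmx R 1 n) : M := \matrix_(i, j) a 0 (ord_diff i j).

Fact diag_cmx_linear : linear diag_cmx.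
Proof.
by move=> r a b; apply/matrixP=> i j; rewrite !mxE mulrnDl mulrnAr.
Qed.

Fact circ_cmx_linear : linear circ_cmx.
Proof. by move=> r a b; apply/matrixP=> i j; rewrite !mxE. Qed.

HB.instance Definition _ := GRing.isLinear.Build R (cmx R 1 n) M *:%R
  diag_cmx diag_cmx_linear.
HB.instance Definition _ := GRing.isLinear.Build R (cmx R 1 n) M *:%R
  circ_cmx circ_cmx_linear.

Definition diag_space : {vspace M} := limg (linfun diag_cmx).

Definition Circ : {vspace M} := limg (linfun circ_cmx).

Lemma mem_diag_space (A : M) :
  reflect (exists a : 'rV[R[i]]_n, A = diag_mx a) (A \in diag_space).
Proof.
apply: (iffP memv_imgP) => [[a _ ->] | [a ->]]; exists a; rewrite ?memvf //.
  by rewrite lfunE.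
by rewrite lfunE.
Qed.

Lemma mem_Circ (A : M) :
  reflect (exists a : 'rV[R[i]]_n, forall i j, A i j = a 0 (ord_diff i j))
          (A \in Circ).
Proof.
apply: (iffP memv_imgP) => [[a _ ->] | [a defA]]; exists a; rewrite ?memvf //.
  by move=> i j; rewrite lfunE mxE.
by rewrite lfunE; apply/matrixP=> i j; rewrite defA mxE.
Qed.

(* The intersection of a space of matrices with su(n), inside su(n). *)
Definition su_cap (V : {vspace M}) : {vspace su} := (linfun su_val @^-1: V)%VS.

Lemma mem_su_cap (V : {vspace M}) (x : su) : (x \in su_cap V) = (su_val x \in V).
Proof. by rewrite -memv_preim lfunE. Qed.

Definition su_diag : {vspace su} := su_cap diag_space.

Definition su_circ : {vspace su} := su_cap Circ.

End SpecialUnitary.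
End ComplexMatrices.

(* Main.v *)
Require Import Defs.
From HB Require Import structures.
From mathcomp Require Import all_boot all_order all_algebra.
From mathcomp Require Import complex.
From mathcomp Require Import reals.

(** Both algebras are abelian, and each one is its own centralizer in su(n).
    Such a subalgebra U is a Cartan subalgebra ([self_centralizing_cartan]):
    it is nilpotent because its brackets vanish, and if x normalizes U, then
    for u in U the bracket w = [x, u] commutes with u, whence
    tr (w^2) = tr (w [x, u]) = tr ([u, w] x) = 0.  As w is skew-hermitian this
    forces w = 0, so x centralizes U and lies in U.

    A matrix that commutes with the diagonal matrices i (E_aa - E_bb) has zero
    off-diagonal entries.  A matrix X that commutes with the skew-hermitian
    circulant matrices P - Q and i (P + Q), where P is the permutation matrix of
    the shift by k <> 0 and Q its adjoint, commutes with P; in entries this says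
    that X is invariant under the translation of both indices by k.  Doing this
    for every k shows that X is circulant.

    Orthogonality follows by averaging, without computing the Killing form.
    The translations of both indices are n automorphisms of su(n), and they fix
    every circulant y.  The Killing form is invariant under automorphisms, so
    n killing x y is the value of the form at the sum of the translates of x and
    at y.  When x is diagonal with trace zero this sum is the scalar matrix
    tr x, that is zero
    ([killing_average_eq0], [su_diag_circ_orthogonal]). *)

Set Implicit Arguments.
Unset Strict Implicit.
Unset Printing Implicit Defensive.

Import Order.TTheory GRing.Theory Num.Theory.
Local Open Scope ring_scope.
Local Open Scope sesquilinear_scope.

(** * Killing form and abelian subalgebras of a Lie algebra *)

Section LieAlgebra.
Variables (K : fieldType) (L : lieType K).
Implicit Types (u v x y : L) (U : {vspace L}) (f g s : 'End(L)).

Lemma lftraceC f g : lftrace (f \o g)%VF = lftrace (g \o f)%VF.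
Proof.
by rewrite /lftrace !(passmx.mxof_comp _ _ (vbasisP _)) mxtrace_mulC.
Qed.

(** An automorphism s conjugates the adjoint maps, as
    ad (s w) = s o ad w o s^-1, and traces are invariant under conjugation. *)
Lemma killing_aut s u v : lker s == 0%VS ->
  (forall x y, s (lie x y) = lie (s x) (s y)) ->
  killing (s u) (s v) = killing u v.
Proof.
move=> s_inj s_lie.
have ad_conj x : (ad (s x) \o s = s \o ad x)%VF.
  by apply/lfunP => y; rewrite !comp_lfunE !adE s_lie.
have ad_s w : (ad (s w) = s \o (ad w \o s^-1))%VF.
  by rewrite comp_lfunA -ad_conj lker0_compfK.
rewrite /killing !ad_s -comp_lfunA lftraceC -!comp_lfunA.
by rewrite lker0_compKf // lker0_compVf // comp_lfun1r.
Qed.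

Lemma killingDl v : {morph (@killing K L)^~ v : u w / u + w}.
Proof.
move=> u w; have adD : ad (u + w) = ad u + ad w.
  apply/lfunP => x; rewrite add_lfunE !adE.
  by have := lie_linearl x 1 u w; rewrite !scale1r.
rewrite /killing adD comp_lfunDl /lftrace -[X in X + _]scale1r.
by rewrite passmx.mxof_linear scale1r raddfD.
Qed.

Lemma killing0l v : killing 0 v = 0.
Proof. by apply: (addIr (killing 0 v)); rewrite -killingDl !add0r. Qed.

(** All the values killing (s i x) y are equal to killing x y, since y is fixed;
    additivity then replaces x by the sum of its images. *)
Lemma killing_average_eq0 (I : finType) (s : I -> 'End(L)) x y :
  #|I|%:R != 0 :> K ->
  (forall i, lker (s i) == 0%VS) ->
  (forall i u v, s i (lie u v) = lie (s i u) (s i v)) ->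
  (forall i, s i y = y) -> \sum_i s i x = 0 -> killing x y = 0.
Proof.
move=> I_neq0 s_inj s_lie s_y avg_x; apply/eqP.
rewrite -(mulrI_eq0 _ (mulfI I_neq0)) mulr_natl -sumr_const.
have <- : \sum_i killing (s i x) y = \sum_(i in I) killing x y.
  by apply: eq_bigr => i _; rewrite -{1}(s_y i) killing_aut.
rewrite -(big_morph (fun u => killing u y) (killingDl y) (killing0l y)) avg_x.
by rewrite killing0l.
Qed.

Lemma abelian_subalgebra U : {in U &, forall u v, lie u v = 0} -> subalgebra U.
Proof. by move=> abU; apply/lievP => u v Uu Uv; rewrite abU ?mem0v. Qed.

Lemma abelian_nilpotent U :
  {in U &, forall u v, lie u v = 0} -> lie_nilpotent U.
Proof.
move=> abU; exists 1%N; apply/eqP; rewrite -subv0.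
by apply/lievP => u v Uu Uv; rewrite abU ?mem0v.
Qed.

End LieAlgebra.

(** * Self-centralizing abelian subalgebras of su(n) *)

Section SpecialUnitaryAlgebra.
Variables (R : realType).

Section AnyOrder.
Variable n : nat.
Notation C := R[i].
Notation su := (su R n).
Implicit Types (x y : su) (A B : 'M[C]_n).

(** For a skew-hermitian A, - tr (A A) is the trace of A times its adjoint,
    hence the sum of the squared moduli of the entries of A. *)
Lemma tr_skew_sqr_eq0 A : A^t* = - A -> \tr (A *m A) = 0 -> A = 0.
Proof.
move=> skA trA0; apply/matrixP => i j; rewrite mxE.
have sum0 : \sum_k \sum_l `|A k l| ^+ 2 = 0.
  transitivity (- \tr (A *m A)); last by rewrite trA0 oppr0.
  rewrite -raddfN /= -mulmxN -skA /mxtrace; apply: eq_bigr => k _.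
  by rewrite mxE; apply: eq_bigr => l _; rewrite !mxE normCK.
have ge0 k : 0 <= \sum_l `|A k l| ^+ 2.
  by apply: sumr_ge0 => l _; rewrite exprn_ge0.
have row0 := psumr_eq0P (fun k _ => ge0 k) sum0.
have := psumr_eq0P (fun l _ => exprn_ge0 2 (normr_ge0 (A i l))) (row0 i isT).
by move/(_ j isT)/eqP; rewrite sqrf_eq0 normr_eq0 => /eqP.
Qed.

Lemma lie_eq0P x y :
  lie x y = 0 <->
  (su_val x : 'M[C]_n) *m su_val y = (su_val y : 'M[C]_n) *m su_val x.
Proof.
split=> [/(congr1 (@su_val R n))|xy].
  by rewrite su_val_lie linear0 => /eqP; rewrite subr_eq0 => /eqP.
by apply: su_val_inj; rewrite su_val_lie linear0 /commutator xy subrr.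
Qed.

Lemma su_val_skew x : (su_val x : 'M[C]_n)^t* = - (su_val x : 'M[C]_n).
Proof. by have := su_valP x; rewrite mem_su_space => /andP[/eqP]. Qed.

Lemma su_val_tr x : \tr (su_val x : 'M[C]_n) = 0.
Proof. by have := su_valP x; rewrite mem_su_space => /andP[_ /eqP]. Qed.

(** The trace form is definite on su(n), which reduces the normalizer of an
    abelian subalgebra to its centralizer. *)
Lemma self_centralizing_cartan (U : {vspace su}) :
  {in U &, forall u v, lie u v = 0} ->
  (forall x, {in U, forall u, lie x u = 0} -> x \in U) ->
  cartan_subalgebra U.
Proof.
move=> abU cUU; split; [exact: abelian_subalgebra|exact: abelian_nilpotent|].
move=> x nUx; apply: cUU => u Uu; apply: su_val_inj; rewrite linear0.
have /lie_eq0P := abU _ _ (nUx u Uu) Uu.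
have := su_val_skew (lie x u); have := su_val_lie x u.
move: (su_val (lie x u)) (su_val x) (su_val u) => W X V defW skW WV.
apply: tr_skew_sqr_eq0 => //.
(* W = XV - VX and W commutes with V, so tr (WXV) = tr (VWX) = tr (WVX). *)
rewrite {2}defW /commutator mulmxBr raddfB /= !mulmxA.
by rewrite [(W : 'M[C]_n) *m V]WV -[(V : 'M[C]_n) *m W *m X]mulmxA
  [\tr ((V : 'M[C]_n) *m _)]mxtrace_mulC subrr.
Qed.

Lemma su_exists A : A^t* = - A -> \tr A = 0 -> exists x, su_val x = A.
Proof.
move=> skA trA; exists (vsproj (su_space R n) A).
by rewrite /su_val vsprojK // mem_su_space skA trA !eqxx.
Qed.

(** * The diagonal subalgebra *)

Lemma mem_su_diag x :
  reflect (exists a : 'rV[C]_n, su_val x = diag_mx a) (x \in su_diag R n).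
Proof. by rewrite mem_su_cap; apply: mem_diag_space. Qed.

Lemma mem_su_diagP x :
  reflect (forall i j, i != j -> su_val x i j = 0) (x \in su_diag R n).
Proof.
apply: (iffP (mem_su_diag x)) => [[a ->] i j /negPf ij|x0].
  by rewrite mxE ij.
exists (\row_j su_val x j j); apply/matrixP => i j; rewrite !mxE.
by have [->|/x0->] := eqVneq i j; rewrite ?mulr1n.
Qed.

Lemma su_diag_abelian : {in su_diag R n &, forall u v, lie u v = 0}.
Proof.
move=> u v /mem_su_diag[a ua] /mem_su_diag[b vb]; apply/lie_eq0P.
by rewrite ua vb diag_mxC.
Qed.

Lemma su_diag_self_centralizing x :
  {in su_diag R n, forall u, lie x u = 0} -> x \in su_diag R n.
Proof.
move=> cx; apply/mem_su_diagP => i j ij.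
(* The (i, j) entry of the bracket of x with i (E_ii - E_jj) is a nonzero
   multiple of x_ij. *)
pose a : 'rV[C]_n := 'i *: (delta_mx 0 i - delta_mx 0 j).
have [||u defu] := @su_exists (diag_mx a).
- apply/matrixP => k l; rewrite !mxE.
  have [->|_] := eqVneq l k; last by rewrite !mulr0n rmorph0 oppr0.
  by rewrite !mulr1n rmorphM rmorphB /= conjCi !rmorph_nat mulNr.
- rewrite mxtrace_diag; under eq_bigr do rewrite mxE.
  rewrite -big_distrr /=; under eq_bigr do rewrite !mxE.
  have sum1 (k : 'I_n) : \sum_l ((0 == 0 :> 'I_1) && (l == k))%:R = 1 :> C.
    by rewrite (bigD1 k) //= !eqxx big1 ?addr0 // => l /negPf ->.
  by rewrite sumrB !sum1 subrr mulr0.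
have Du : u \in su_diag R n by apply/mem_su_diag; exists a.
have /lie_eq0P/matrixP/(_ i j) := cx u Du.
rewrite defu mul_mx_diag mul_diag_mx !mxE !eqxx (negPf ij) eq_sym (negPf ij) /=.
rewrite subr0 sub0r mulr1 mulrN1 mulrN => /eqP.
rewrite mulrC -subr_eq0 -opprD oppr_eq0 -mulr2n mulrn_eq0 mulf_eq0.
by rewrite (negPf (neq0Ci _)) => /eqP.
Qed.

End AnyOrder.

(** * The circulant subalgebra

    The indices form the group Z/n, n > 0. *)

Section CyclicIndices.
Variable m : nat.
Notation n := m.+1.
Notation C := R[i].
Notation su := (su R n).
Implicit Types (x y : su) (i j k : 'I_n).

Lemma ord_diffE i j : ord_diff i j = j - i.
Proof. by apply: val_inj; rewrite /= modnDmr. Qed.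

Definition translate k (A : cmx R n n) : cmx R n n :=
  \matrix_(i, j) A (i + k) (j + k).

(** Circulant matrices are the fixed points of the translations: this is the
    form in which both their centralizer and their orthogonality are computed. *)
Lemma mem_su_circP x :
  reflect (forall k, translate k (su_val x) = su_val x) (x \in su_circ R n).
Proof.
rewrite mem_su_cap; apply: (iffP (mem_Circ _)) => [[a xE] k|xk].
  apply/matrixP => i j.
  by rewrite mxE !xE !ord_diffE opprD addrACA subrr addr0.
exists (\row_d su_val x 0 d) => i j.
by rewrite mxE ord_diffE -{2}[su_val x](xk i) mxE add0r subrK.
Qed.

Lemma su_circ_shift x i j k :
  x \in su_circ R n -> su_val x (i + k) (j + k) = su_val x i j.
Proof. by move/mem_su_circP/(_ k)/matrixP/(_ i j) => <-; rewrite mxE. Qed.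

Lemma su_circ_abelian : {in su_circ R n &, forall u v, lie u v = 0}.
Proof.
move=> u v Cu Cv; apply/lie_eq0P/matrixP => i j; rewrite !mxE.
(* The substitution k -> i + j - k exchanges the steps i -> k and k -> j, and
   an entry of a circulant matrix depends only on its step. *)
rewrite (reindex_inj (subrI (i + j))) /=; apply: eq_bigr => k _.
rewrite mulrC; congr (_ * _).
  by rewrite -(su_circ_shift _ _ (k - j) Cv) subrKA addrK subrKC.
by rewrite -(su_circ_shift _ _ (k - i) Cu) subrKA subrKC [i + j]addrC addrK.
Qed.

(** The shift matrices P k are neither skew-hermitian nor, for k = 0, of trace
    zero; for k <> 0 they are complex combinations of two elements of su(n). *)
Lemma su_circ_self_centralizing x :
  {in su_circ R n, forall u, lie x u = 0} -> x \in su_circ R n.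
Proof.
move=> cx; apply/mem_su_circP => k.
have [->|k0] := eqVneq k 0.
  by apply/matrixP => i j; rewrite mxE !addr0.
pose P l : 'M[C]_n := \matrix_(i, j) (j == i + l)%:R.
have P_adj l : (P l)^t* = P (- l).
  apply/matrixP => i j; rewrite !mxE rmorph_nat; congr (_ : bool)%:R.
  by rewrite -subr_eq eq_sym.
have P_tr l : l != 0 -> \tr (P l) = 0.
  move=> l0; rewrite /mxtrace big1 // => i _.
  by rewrite mxE addrC -subr_eq subrr eq_sym (negPf l0).
have eq_shift h i j l : (j + h == i + h + l) = (j == i + l).
  by rewrite addrAC (inj_eq (addIr h)).
pose X : 'M[C]_n := su_val x.
have comm (A : 'M[C]_n) : A^t* = - A -> \tr A = 0 ->
    (forall h, translate h A = A) -> comm_mx X A.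
  move=> skA trA shA; have [u uA] := su_exists skA trA.
  have Cu : u \in su_circ R n by apply/mem_su_circP => h; rewrite uA shA.
  by have /lie_eq0P := cx u Cu; rewrite uA.
have Nk0 : - k != 0 by rewrite oppr_eq0.
have comm_re : comm_mx X (P k - P (- k)).
  apply: comm.
  - by rewrite raddfB map_mxB /= !P_adj opprK opprB.
  - by rewrite raddfB /= !P_tr // subrr.
  - by move=> h; apply/matrixP => i j; rewrite !mxE !eq_shift.
have comm_im : comm_mx X ('i *: (P k + P (- k))).
  apply: comm.
  - rewrite linearZ /= map_mxZ raddfD map_mxD /= !P_adj.
    by rewrite opprK conjCi scaleNr addrC.
  - by rewrite linearZ /= raddfD /= !P_tr // addr0 mulr0.
  - by move=> h; apply/matrixP => i j; rewrite !mxE !eq_shift.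
have xP : comm_mx X (P k).
  have -> : P k = 2^-1 *: ((P k - P (- k)) - 'i *: ('i *: (P k + P (- k)))).
    rewrite scalerA -expr2 sqrCi scaleN1r opprK addrC addrACA subrr addr0.
    rewrite -[P k + P k]mulr2n -[P k *+ 2]scaler_nat scalerA.
    by rewrite mulVf ?scale1r ?pnatr_eq0.
  rewrite /comm_mx -scalemxAr -scalemxAl mulmxBr mulmxBl; congr (_ *: (_ - _)).
    exact: comm_re.
  by rewrite -scalemxAr -scalemxAl comm_im.
(* X P_k = P_k X at (i, j + k) reads X i j = X (i + k) (j + k). *)
apply/matrixP => i j; rewrite mxE.
have /matrixP/(_ i (j + k)) := xP.
rewrite !mxE (bigD1 j) //= mxE eqxx mulr1 big1 ?addr0; last first.
  by move=> l lj; rewrite mxE (inj_eq (addIr k)) eq_sym (negPf lj) mulr0.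
rewrite (bigD1 (i + k)) //= mxE eqxx mul1r big1 ?addr0 => [-> //|l lj].
by rewrite mxE (negPf lj) mul0r.
Qed.

(** * Orthogonality of the two subalgebras *)

Lemma translate_commutator k (A B : cmx R n n) :
  translate k (commutator A B) = commutator (translate k A) (translate k B).
Proof.
apply/matrixP => i j; rewrite !mxE.
by congr (_ - _); rewrite (reindex_inj (addIr k)); apply: eq_bigr => l _;
  rewrite !mxE.
Qed.

Lemma translate_su k x : translate k (su_val x) \in su_space R n.
Proof.
rewrite mem_su_space; apply/andP; split; apply/eqP.
  apply/matrixP => i j; rewrite !mxE.
  by have /matrixP/(_ (i + k) (j + k)) := su_val_skew x; rewrite !mxE.
rewrite -(su_val_tr x) [RHS](reindex_inj (addIr k)).
by apply: eq_bigr => i _; rewrite mxE.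
Qed.

Definition su_translate k x : su :=
  vsproj (su_space R n) (translate k (su_val x)).

Lemma su_val_translate k x : su_val (su_translate k x) = translate k (su_val x).
Proof. by rewrite /su_val vsprojK // translate_su. Qed.

Fact su_translate_linear k : linear (su_translate k).
Proof.
move=> a x y; apply: su_val_inj; rewrite linearP /= !su_val_translate linearP.
by apply/matrixP => i j; rewrite !mxE.
Qed.

HB.instance Definition _ k := GRing.isLinear.Build R su su *:%R
  (su_translate k) (su_translate_linear k).

Lemma su_diag_circ_orthogonal x y :
  x \in su_diag R n -> y \in su_circ R n -> killing x y = 0.
Proof.
move=> /mem_su_diagP Dx /mem_su_circP Cy.
apply: (killing_average_eq0 (s := fun k => linfun (su_translate k))).
- by rewrite card_ord pnatr_eq0.
- move=> k; apply/lker0P => u v; rewrite !lfunE /= => /(congr1 (@su_val R n)).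
  rewrite !su_val_translate => /matrixP uv; apply/su_val_inj/matrixP => i j.
  by have := uv (i - k) (j - k); rewrite !mxE !subrK.
- move=> k u v; rewrite !lfunE /=; apply: su_val_inj.
  by rewrite su_val_lie !su_val_translate su_val_lie translate_commutator.
- by move=> k; rewrite lfunE; apply: su_val_inj; rewrite /= su_val_translate.
apply: su_val_inj; rewrite linear_sum linear0; apply/matrixP => i j.
rewrite [LHS]summxE mxE.
have [<-|ij] := eqVneq i j; last first.
  apply: big1 => k _; rewrite lfunE /= su_val_translate mxE Dx //.
  by rewrite (inj_eq (addIr k)).
(* Each diagonal entry of the sum of the translates is the trace of x. *)
rewrite -[RHS](su_val_tr x) [RHS](reindex_inj (addrI i)).
by apply: eq_bigr => k _; rewrite lfunE /= su_val_translate mxE.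
Qed.

End CyclicIndices.

End SpecialUnitaryAlgebra.

Theorem theorem6p1 (R : realType) (n : nat) (n_gt0 : (0 < n)%N) :
  [/\ cartan_subalgebra (su_diag R n),
      cartan_subalgebra (su_circ R n) &
      orthogonal_wrt (fun x y : su R n => - killing x y)
        (su_diag R n) (su_circ R n)].
Proof.
case: n n_gt0 => // m _; split.
- apply: self_centralizing_cartan; first exact: su_diag_abelian.
  exact: su_diag_self_centralizing.
- apply: self_centralizing_cartan; first exact: su_circ_abelian.
  exact: su_circ_self_centralizing.
by move=> x y Dx Cy; rewrite su_diag_circ_orthogonal ?oppr0.
Qed.
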